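(* Let $0\le m<n$ be integers. If $s(x)$ is a complex polynomial of degree $n-m-1$, then $$\tilde U_n\,s(x)=(1-x)^m\frac{(n-m)!}{n!}\,\tilde U_{n-m}\,s(x).$$ Respectively, if $c(x)$ is a complex polynomial of degree $<n-m$, then $$\tilde U_n^{-1}\big((1-x)^m c(x)\big)=\frac{n!}{(n-m)!}\,\tilde U_{n-m}^{-1}c(x).$$
   Context: The Euler polynomials $A_k(x)$ are defined by $\frac{A_k(x)}{(1-x)^{k+1}}=\sum_{m\ge0}m^kx^m$, and $\tilde A_k(x)=A_k(x)/x$ for $k\ge1$. For an integer $N\ge1$, $\tilde U_N$ is the linear operator on the space $\mathcal P_{N-1}$ of polynomials of degree at most $N-1$ with $\tilde U_N x^p=\frac{1}{N!}(1-x)^{N-1-p}\tilde A_{p+1}(x)$, $p=0,\dots,N-1$; it is invertible, with $\tilde U_N^{-1}x^p=(x-1)_p[x+1]_{N-p-1}$, where $(\varphi)_k=\varphi(\varphi-1)\cdots(\varphi-k+1)$ and $[\varphi]_k=\varphi(\varphi+1)\cdots(\varphi+k-1)$, both equal to $1$ for $k=0$. *)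

(* Defs.v *)
From HB Require Import structures.
From mathcomp Require Import all_boot all_order all_algebra.
From mathcomp Require Import reals complex.
From mathcomp Require Import ring.

Set Implicit Arguments.
Unset Strict Implicit.
Unset Printing Implicit Defensive.

Import Order.TTheory GRing.Theory Num.Theory.
Local Open Scope ring_scope.

Section EulerPoly.
Variable F : fieldType.

(* The partial sum, up to degree < M, of the series \sum_(m >= 0) m^k x^m
   (with the convention 0^0 = 1). *)
Definition power_series_upto (k M : nat) : {poly F} :=
  \poly_(m < M) (m ^ k)%:R.

(* A_k = (1 - x)^(k+1) \sum_(m >= 0) m^k x^m.  As A_k has degree at most k, it
   is determined by this product modulo x^(k+1); [euler_polyP] below proves
   that the identity holds modulo every power of x, i.e. for formal power
   series. *)
Definition euler_poly (k : nat) : {poly F} :=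
  take_poly k.+1 ((1 - 'X) ^+ k.+1 * power_series_upto k k.+1).

Definition euler_tpoly (k : nat) : {poly F} := euler_poly k %/ 'X.

(* The classical recurrence, obtained by applying x d/dx to the series. *)
Fixpoint euler_rec (k : nat) : {poly F} :=
  if k is k'.+1 then
    'X * (1 - 'X) * (euler_rec k')^`() + k'.+1%:R * 'X * euler_rec k'
  else 1.

Lemma size_euler_rec k : (size (euler_rec k) <= k.+1)%N.
Proof.
elim: k => [|k IH] /=; first by rewrite size_poly1.
have hX : size ('X * (1 - 'X) : {poly F}) = 3%N.
  have -> : 'X * (1 - 'X) = - ('X * ('X - 1%:P)) :> {poly F} by ring.
  by rewrite size_polyN size_Mmonic ?polyX_eq0 ?monicXsubC // size_XsubC size_polyX.
rewrite (leq_trans (size_polyD _ _)) // geq_max; apply/andP; split.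
  have [->|nz] := eqVneq (euler_rec k)^`() 0; first by rewrite mulr0 size_poly0.
  have nz' : euler_rec k != 0 by apply: contraNneq nz => ->; rewrite linear0.
  rewrite (leq_trans (size_polyMleq _ _)) // hX /=.
  by have := leq_trans (lt_size_deriv nz') IH.
rewrite -mulrA -[_.+1%:R]/(_.+1%:R) -polyC_natr mul_polyC.
rewrite (leq_trans (size_scale_leq _ _)) //.
rewrite (leq_trans (size_polyMleq _ _)) // size_polyX /=.
by rewrite ltnS.
Qed.

Lemma euler_rec_spec k M : exists q : {poly F},
  (1 - 'X) ^+ k.+1 * power_series_upto k M = euler_rec k + 'X^M * q.
Proof.
elim: k => [|k [q IH]] /=.
  exists (-1); elim: M => [|M IHM].
    by rewrite /power_series_upto poly_def big_ord0 expr0; ring.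
  have -> : power_series_upto 0 M.+1 = power_series_upto 0 M + 'X^M.
    rewrite /power_series_upto !poly_def big_ord_recr /=.
    by rewrite expn0 scale1r.
  by rewrite mulrDr IHM expr1 exprS; ring.
have hT : power_series_upto k.+1 M = 'X * (power_series_upto k M)^`().
  apply/polyP => i; rewrite coefXM coef_poly; case: i => [|i] /=.
    by rewrite exp0n //; case: ifP.
  rewrite coef_deriv coef_poly; case: ifP => _; last by rewrite mul0rn.
  by rewrite expnSr natrM mulr_natr.
have hX : 'X * ('X^M)^`() = M%:R * 'X^M :> {poly F}.
  case: M {IH hT} => [|M]; first by rewrite expr0 derivC mulr0 mul0r.
  by rewrite derivXn /= mulrnAr -exprS -mulr_natl.
have := congr1 (fun p => 'X * (1 - 'X) * p^`()) IH.
rewrite !derivM !derivD !derivM deriv_exp derivB derivX -polyC1 derivC polyC1.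
rewrite sub0r -mulr_natl /= => hD.
exists (k.+1%:R * 'X * q + (1 - 'X) * M%:R * q + 'X * (1 - 'X) * q^`()).
rewrite hT exprS.
have -> : (1 - 'X) * (1 - 'X) ^+ k.+1 * ('X * (power_series_upto k M)^`()) =
    'X * (1 - 'X) * (k.+1%:R * (-1 * (1 - 'X) ^+ k) * power_series_upto k M +
      (1 - 'X) ^+ k.+1 * (power_series_upto k M)^`()) +
    k.+1%:R * 'X * ((1 - 'X) ^+ k.+1 * power_series_upto k M) :> {poly F}.
  by rewrite exprS; ring.
rewrite hD IH.
have -> : 'X * (1 - 'X) * ((euler_rec k)^`() +
    (('X^M)^`() * q + 'X^M * q^`())) =
  'X * (1 - 'X) * (euler_rec k)^`() +
  ((1 - 'X) * ('X * ('X^M)^`()) * q + 'X * (1 - 'X) * 'X^M * q^`()) :> {poly F}.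
  by ring.
by rewrite hX; ring.
Qed.

Lemma euler_polyE k : euler_poly k = euler_rec k.
Proof.
have [q h] := euler_rec_spec k k.+1.
by rewrite /euler_poly h mulrC take_polyDMXn // size_euler_rec.
Qed.

Lemma size_euler_poly k : (size (euler_poly k) <= k.+1)%N.
Proof. exact: size_take_poly. Qed.

Lemma euler_polyP k M :
  take_poly M ((1 - 'X) ^+ k.+1 * power_series_upto k M) =
  take_poly M (euler_poly k).
Proof.
have [q h] := euler_rec_spec k M.
by rewrite h euler_polyE take_polyD mulrC take_polyMXn_0 addr0.
Qed.

Lemma euler_tpolyP k : (0 < k)%N -> 'X * euler_tpoly k = euler_poly k.
Proof.
case: k => // k _; rewrite /euler_tpoly mulrC divpK //.
rewrite euler_polyE /= -!mulrA -[_.+1%:R * _]mulrCA -mulrDr.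
exact: dvdp_mulIl.
Qed.

Lemma size_euler_tpoly k : (0 < k)%N -> (size (euler_tpoly k) <= k)%N.
Proof.
move=> k0; have := size_euler_poly k; rewrite -(euler_tpolyP k0) mulrC.
have [->|nz] := eqVneq (euler_tpoly k) 0; first by rewrite size_poly0.
by rewrite size_mulX.
Qed.

Definition euler_op_monomial (N p : nat) : {poly F} :=
  (N`!%:R)^-1 *: ((1 - 'X) ^+ (N - 1 - p) * euler_tpoly p.+1).

(* {poly_N F} is the space of polynomials of degree at most N - 1, and npolyp N
   injects polynomials into it (by truncation when the degree is too
   large).  Truncation is never effective here: see [euler_opE]. *)
Definition euler_op (N : nat) : 'End({poly_N F}) :=
  linfun (fun s : {poly_N F} =>
    npolyp N (\sum_(p < N) s`_p *: euler_op_monomial N p)).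

Lemma size_euler_op_monomial N p :
  (p < N)%N -> (size (euler_op_monomial N p) <= N)%N.
Proof.
move=> pN; rewrite (leq_trans (size_scale_leq _ _)) //.
rewrite (leq_trans (size_polyMleq _ _)) //.
have h1 : (size ((1 - 'X) ^+ (N - 1 - p) : {poly F}) <= (N - 1 - p).+1)%N.
  rewrite (leq_trans (size_poly_exp_leq _ _)) //.
  by rewrite -opprB size_polyN -polyC1 size_XsubC mul1n.
have h2 := size_euler_tpoly (ltn0Sn p).
rewrite -subn1 leq_subLR (leq_trans (leq_add h1 h2)) //.
by rewrite -subnDA add1n addSn subnK.
Qed.

Lemma euler_opE N (s : {poly_N F}) :
  euler_op N s = \sum_(p < N) s`_p *: euler_op_monomial N p :> {poly F}.
Proof.
pose g (t : {poly_N F}) := npolyp N (\sum_(p < N) t`_p *: euler_op_monomial N p).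
have gE t : g t = \sum_(p < N) t`_p *: euler_op_monomial N p :> {poly F}.
  rewrite /g npolypK // (leq_trans (size_sum _ _ _)) //.
  apply/bigmax_leqP => p _.
  exact: leq_trans (size_scale_leq _ _) (size_euler_op_monomial (ltn_ord p)).
have glin : linear g.
  move=> a u v; apply: val_inj.
  rewrite [LHS]gE linearP /= !gE scaler_sumr -big_split /=.
  by apply: eq_bigr => p _; rewrite coefD coefZ scalerDl scalerA.
pose G := HB.pack_for {linear {poly_N F} -> {poly_N F}} g
  (GRing.isLinear.Build F {poly_N F} {poly_N F} _ g glin).
by rewrite -[euler_op N]/(linfun G) lfunE gE.
Qed.

Lemma euler_opXn N p : (p < N)%N ->
  euler_op N (npolyp N 'X^p) =
  (N`!%:R)^-1 *: ((1 - 'X) ^+ (N - 1 - p) * euler_tpoly p.+1) :> {poly F}.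
Proof.
move=> pN; rewrite euler_opE npolypK ?size_polyXn //.
rewrite (bigD1 (Ordinal pN)) //= coefXn eqxx scale1r big1 ?addr0 // => i ip.
by rewrite coefXn (negbTE (_ : val i != p)) ?scale0r.
Qed.

End EulerPoly.

Lemma lker_euler_op (F : numFieldType) (N : nat) :
  (lker (euler_op F N) == 0)%VS.
Proof.
rewrite -subv0; apply/subvP => s; rewrite memv_ker memv0 => /eqP s0.
pose M := N.+2.
pose T : {poly F} := \sum_(p < N) s`_p *: power_series_upto F p.+1 M.
have sT : (size T <= M)%N.
  rewrite (leq_trans (size_sum _ _ _)) //; apply/bigmax_leqP => p _.
  by rewrite (leq_trans (size_scale_leq _ _)) // size_poly.
have hdvd : 'X^M %| T.
  rewrite -(@Gauss_dvdpr _ _ ((1 - 'X) ^+ N.+1)); last first.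
    rewrite coprimep_expl // coprimep_expr // coprimep_sym coprimepX.
    by rewrite rootE !hornerE subr0 oner_eq0.
  have -> : (1 - 'X) ^+ N.+1 * T = \sum_(p < N) s`_p *:
      ((1 - 'X) ^+ (N - 1 - p) *
        ((1 - 'X) ^+ p.+2 * power_series_upto F p.+1 M)).
    rewrite mulr_sumr; apply: eq_bigr => p _.
    rewrite -scalerAr mulrA -exprD; congr (_ *: (_ ^+ _ * _)).
    by rewrite -subnDA add1n addnS subnK.
  have s0X : \sum_(p < N) s`_p *: ((1 - 'X) ^+ (N - 1 - p) *
      euler_poly F p.+1) = 0.
    have := congr1 (fun t : {poly_N F} => (N`!)%:R *: ('X * polyn t)) s0.
    rewrite /= euler_opE mulr0 scaler0 => h; rewrite -[RHS]h.
    rewrite mulr_sumr scaler_sumr; apply: eq_bigr => p _.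
    rewrite -(euler_tpolyP _ (ltn0Sn p)) /euler_op_monomial.
    rewrite -!scalerAr !scalerA [_%:R * (_ / _)]mulrCA mulfV ?mulr1; last first.
      by rewrite pnatr_eq0 -lt0n fact_gt0.
    by congr (_ *: _); ring.
  have hq (p : 'I_N) : exists q : {poly F},
      (1 - 'X) ^+ p.+2 * power_series_upto F p.+1 M =
      euler_poly F p.+1 + 'X^M * q.
    by rewrite euler_polyE; exact: euler_rec_spec.
  have [q qE] := fin_all_exists hq.
  rewrite (eq_bigr (fun p : 'I_N =>
    s`_p *: ((1 - 'X) ^+ (N - 1 - p) * euler_poly F p.+1) +
    'X^M * (s`_p *: ((1 - 'X) ^+ (N - 1 - p) * q p)))); last first.
    by move=> p _; rewrite qE mulrDr scalerDr -scalerAr; congr (_ + _ *: _); ring.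
  by rewrite big_split /= s0X add0r -mulr_sumr dvdp_mulIl.
have T0 : T = 0.
  apply/eqP; apply: contraTT hdvd => nz; apply/negP => /(dvdp_leq nz).
  rewrite size_polyXn ltnNge sT //.
have hroot (m : nat) : (m < N.+1)%N -> root (polyn s) m.+1%:R.
  move=> mN; have := congr1 (fun p : {poly F} => p`_m.+1) T0.
  rewrite coef0 /T coef_sum => h; apply/rootP.
  rewrite (horner_coef_wide _ (size_npoly s)).
  apply: (@mulIf _ m.+1%:R); first by rewrite pnatr_eq0.
  rewrite mul0r -[RHS]h mulr_suml; apply: eq_bigr => p _.
  by rewrite coefZ coef_poly ltnS mN natrX exprS -mulrA [_ * m.+1%:R]mulrC.
have := @max_poly_roots F (polyn s) [seq m.+1%:R | m <- iota 0 N.+1].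
case: (eqVneq s 0) => // nz /(_ nz).
have -> : all (root (polyn s)) [seq m.+1%:R | m <- iota 0 N.+1].
  by apply/allP => x /mapP[m]; rewrite mem_iota add0n => /andP[_ mN] ->; apply: hroot.
rewrite map_inj_uniq ?iota_uniq; last first.
  by move=> a b /eqP; rewrite eqr_nat eqSS => /eqP.
move=> /(_ isT isT); rewrite size_map size_iota => h.
by have := leq_trans h (size_npoly s); rewrite ltnNge leqnSn.
Qed.

(* Main.v *)
Require Import Defs.
From HB Require Import structures.
From mathcomp Require Import all_boot all_order all_algebra.
From mathcomp Require Import reals complex.
From mathcomp Require Import zify ring.

Set Implicit Arguments.
Unset Strict Implicit.
Unset Printing Implicit Defensive.

Import Order.TTheory GRing.Theory Num.Theory.
Local Open Scope ring_scope.
Local Open Scope complex_scope.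

(** For [p < n - m], the images of ['X^p] under the operators of orders [n] and [n - m] contain the
    same Euler factor. They differ only by the power [(1 - 'X) ^+ m] and the ratio of the
    factorials, neither of which depends on [p], so linearity gives the first identity. The second
    is the first read backwards: by [lker_euler_op] the operators are injective on
    finite-dimensional spaces, hence invertible. *)

Lemma euler_op_npolyp (F : numFieldType) (m n : nat) (s : {poly F}) :
  (m < n)%N -> (size s <= n - m)%N ->
  euler_op F n (npolyp n s) =
    (1 - 'X) ^+ m *
    (((n - m)`!%:R / n`!%:R) *: (euler_op F (n - m) (npolyp (n - m) s) : {poly F}))
    :> {poly F}.
Proof.
move=> /ltnW lemn sz.
rewrite !euler_opE !npolypK ?(leq_trans sz) ?leq_subr //.
rewrite -(big_mkord predT (fun p => s`_p *: euler_op_monomial F n p)).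
(* Cut the sum at [n - m]: beyond it the coefficients of [s] vanish. *)
rewrite (big_cat_nat (leq0n (n - m)) (leq_subr m n)) /=.
rewrite [X in _ + X]big_nat_cond [X in _ + X]big1 ?addr0; last first.
  by move=> p /andP[/andP[lep _] _]; rewrite nth_default ?scale0r // (leq_trans sz).
rewrite big_mkord scaler_sumr mulr_sumr; apply: eq_bigr => p _.
rewrite /euler_op_monomial !scalerA -scalerAr mulrA -exprD; congr (_ *: (_ ^+ _ * _)).
  by field; rewrite !pnatr_eq0 -!lt0n !fact_gt0.
(* The exponents agree, [n - 1 - p = m + (n - m - 1 - p)], with no truncation since [p < n - m]. *)
have := ltn_ord p; lia.
Qed.

Lemma inv_euler_op_npolyp (F : numFieldType) (m n : nat) (c : {poly F}) :
  (m < n)%N -> (size c <= n - m)%N ->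
  (euler_op F n)^-1%VF (npolyp n ((1 - 'X) ^+ m * c)) =
    (n`!%:R / (n - m)`!%:R) *:
    ((euler_op F (n - m))^-1%VF (npolyp (n - m) c) : {poly F})
    :> {poly F}.
Proof.
move=> ltmn sz; set t := (euler_op F (n - m))^-1%VF _; set k := _ / _.
have k_neq0 : k != 0 by rewrite mulf_neq0 ?invr_eq0 // pnatr_eq0 -lt0n fact_gt0.
have szt : (size t <= n)%N by rewrite (leq_trans (size_npoly t)) ?leq_subr.
(* It is enough to exhibit [k *: t] as a preimage; [k] is the inverse of the factor in
   [euler_op_npolyp]. *)
suff -> : npolyp n ((1 - 'X) ^+ m * c) = euler_op F n (k *: npolyp n t).
  by rewrite lker0_lfunK ?lker_euler_op //= npolypK.
have Unt : euler_op F n (k *: npolyp n t) = (1 - 'X) ^+ m * c :> {poly F}.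
  rewrite linearZ /= (euler_op_npolyp ltmn) ?size_npoly // -invf_div -/k.
  rewrite (val_inj (npolypK (size_npoly t)) : npolyp _ t = t).
  by rewrite lker0_lfunVK ?lker_euler_op // npolypK // -scalerAr scalerKV.
(* [Unt] also bounds the size of [(1 - 'X) ^+ m * c] by [n], as a value of the operator, so
   [npolyp n] truncates nothing. *)
by apply: val_inj; rewrite /= npolypK -Unt ?size_npoly.
Qed.

Theorem theorem3 (R : realType) (m n : nat) (hmn : (m < n)%N) :
  (forall s : {poly R[i]}, (size s <= n - m)%N ->
     euler_op R[i] n (npolyp n s) =
       (1 - 'X) ^+ m *
       (((n - m)`!%:R / n`!%:R) *: (euler_op R[i] (n - m) (npolyp (n - m) s) : {poly R[i]}))
       :> {poly R[i]})
  /\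
  (forall c : {poly R[i]}, (size c <= n - m)%N ->
     (euler_op R[i] n)^-1%VF (npolyp n ((1 - 'X) ^+ m * c)) =
       (n`!%:R / (n - m)`!%:R) *:
       ((euler_op R[i] (n - m))^-1%VF (npolyp (n - m) c) : {poly R[i]})
       :> {poly R[i]}).
Proof.
by split=> p; [exact: euler_op_npolyp | exact: inv_euler_op_npolyp].
Qed.
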